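(* Let $\bar\ell:\mathbb{R}^K\to\mathbb{R}$ be the multinomial logistic loss associated with a choice vector $(y_0,y_1,\dots,y_K)\in\{0,1\}^{K+1}$, $\sum_{i=0}^Ky_i=1$. Then for all $\mathbf{u},\mathbf{z}_1,\mathbf{z}_2\in\mathbb{R}^K$, $$\mathbf{u}^\top\left(\int_0^1(1-s)\nabla^2\bar\ell(\mathbf{z}_1+s(\mathbf{z}_2-\mathbf{z}_1))\,ds\right)\mathbf{u}\ \ge\ \frac{1}{2+3\sqrt2\,\|\mathbf{z}_2-\mathbf{z}_1\|_\infty}\,\mathbf{u}^\top\nabla^2\bar\ell(\mathbf{z}_1)\mathbf{u}.$$
   Context: The multinomial logistic loss with outside option $0$ is $\bar\ell(\mathbf{z})=-\sum_{i=0}^{K}y_i\log\left(\frac{\exp(z_i)}{1+\sum_{j=1}^K\exp(z_j)}\right)$ for $\mathbf{z}=(z_1,\dots,z_K)\in\mathbb{R}^K$, with the convention $z_0=0$. *)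

(* Defs.v *)
From HB Require Import structures.
From mathcomp Require Import all_boot all_order all_algebra.
From mathcomp Require Import all_classical all_reals all_analysis.

Set Implicit Arguments.
Unset Strict Implicit.
Unset Printing Implicit Defensive.

Import Order.TTheory GRing.Theory Num.Theory.
Import numFieldNormedType.Exports.

Local Open Scope classical_set_scope.
Local Open Scope ring_scope.

(* z = (z_1, ..., z_K) is stored at indices 0, ..., K-1 of 'cV[R]_K, so z_i
   with 1 <= i <= K is found at [i = lift ord0 j]; the outside option is
   i = 0, with the convention z_0 = 0. *)
Definition with_outside (R : realType) (K : nat) (z : 'cV[R]_K)
    (i : 'I_K.+1) : R :=
  if unlift ord0 i is Some j then z j 0 else 0.

Definition mnl_loss (R : realType) (K : nat) (y : 'cV[R]_K.+1)
    (z : 'cV[R]_K) : R :=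
  - \sum_(i < K.+1)
      y i 0 * ln (expR (with_outside z i) / (1 + \sum_(j < K) expR (z j 0))).

Definition choice_vector (R : realType) (K : nat) (y : 'cV[R]_K.+1) : Prop :=
  (forall i, y i 0 = 0 \/ y i 0 = 1) /\ \sum_(i < K.+1) y i 0 = 1.

(* [delta_mx i 0] is the i-th vector of the canonical basis of R^K. *)
Definition hessian (R : realType) (K : nat) (f : 'cV[R]_K -> R)
    (z : 'cV[R]_K) : 'M[R]_K :=
  \matrix_(i < K, j < K)
    'D_(delta_mx i 0) (fun w : 'cV[R]_K => 'D_(delta_mx j 0) f w) z.

(* The integral of a matrix-valued function is taken entrywise. *)
Definition mx_integral01 (R : realType) (m n : nat)
    (F : R -> 'M[R]_(m, n)) : 'M[R]_(m, n) :=
  \matrix_(i < m, j < n) \int[lebesgue_measure]_(s in `[0, 1]) F s i j.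

Definition quad_form (R : realType) (K : nat) (A : 'M[R]_K)
    (u : 'cV[R]_K) : R :=
  (u^T *m A *m u) 0 0.

(* Main.v *)
(** Along the segment [z1 + s d] each choice probability, that of the outside
    option included, is at least [exp (- 2 s |d|)] times its value at [z1]: the
    numerator and the normalising sum each change by a factor of at most
    [exp (s |d|)].  The Hessian form is the variance of [u] (with [u_0 = 0])
    under these probabilities; a variance is a minimum of weighted sums of
    squares, so it decays by at most the same factor.  It remains to see that
    the integral of [(1 - s) exp (- a s)] over [[0, 1]] is at least
    [1 / (2 + a)] for [a = 2 |d|], and [2 <= 3 sqrt 2]. *)
Require Import Defs.
From HB Require Import structures.
From mathcomp Require Import all_boot all_order all_algebra.
From mathcomp Require Import all_classical all_reals all_analysis.
From mathcomp Require Import ring lra.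

Set Implicit Arguments.
Unset Strict Implicit.
Unset Printing Implicit Defensive.

Import Order.TTheory GRing.Theory Num.Theory.
Import numFieldNormedType.Exports.

Local Open Scope classical_set_scope.
Local Open Scope ring_scope.

(** * Directional derivatives, reduced to one-variable derivatives along lines *)

Lemma is_derive_line (R : realType) (V : normedModType R) (f : V -> R)
    (z v : V) (df : R) :
  is_derive (0 : R) 1 (fun t : R => f (z + t *: v)) df -> is_derive z v f df.
Proof.
move=> [dbl val].
have E : (fun h : R => h^-1 *: (f (z + (h *: 1 + 0 : R) *: v) - f (z + (0 : R) *: v)))
   = (fun h : R => h^-1 *: (f (h *: v + z) - f z)).
  apply/funext => h; rewrite scale0r !addr0 [z + _]addrC.
  by have -> : h *: (1 : R) = h by exact: mulr1.
by move: dbl val; rewrite /derivable /derive /= E => dbl val; split.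
Qed.

Definition partition_fun (R : realType) (K : nat) (z : 'cV[R]_K) : R :=
  1 + \sum_(i < K) expR (z i 0).

Definition softmax (R : realType) (K : nat) (z : 'cV[R]_K) (i : 'I_K) : R :=
  expR (z i 0) / partition_fun z.

Lemma partition_fun_gt0 (R : realType) (K : nat) (z : 'cV[R]_K) :
  0 < partition_fun z.
Proof. by rewrite ltr_wpDr// sumr_ge0// => i _; exact: expR_ge0. Qed.

Lemma is_derive_expR_line (R : realType) (K : nat) (z v : 'cV[R]_K) i (t : R) :
  is_derive t 1 (fun s : R => expR ((z + s *: v) i 0))
    (v i 0 * expR ((z + t *: v) i 0)).
Proof.
have -> : (fun s : R => expR ((z + s *: v) i 0)) =
    expR \o (fun s : R => z i 0 + s * v i 0).
  by apply/funext => s /=; rewrite !mxE.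
rewrite mulrC !mxE; apply: is_derive1_comp.
apply: (@is_derive_eq _ _ _ (cst (z i 0) + (id * cst (v i 0)))).
by rewrite /cst /= scaler0 !add0r /GRing.scale /= mulr1.
Qed.

Lemma is_derive_partition_fun_line (R : realType) (K : nat)
    (z v : 'cV[R]_K) (t : R) :
  is_derive t 1 (fun s : R => partition_fun (z + s *: v))
    (\sum_(i < K) v i 0 * expR ((z + t *: v) i 0)).
Proof.
have -> : (fun s : R => partition_fun (z + s *: v)) =
    cst 1 + \sum_(i < K) (fun s : R => expR ((z + s *: v) i 0)).
  by apply/funext => s; rewrite fctE fct_sumE.
rewrite -[X in is_derive _ _ _ X]add0r.
apply: is_deriveD; apply: is_derive_sum => i; exact: is_derive_expR_line.
Qed.

(** This is a logarithmic derivative: the numerator contributes [v j 0], and the normalising sum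
    contributes minus the mean of [v] (0 at the outside option) under the probabilities at [w]. *)
Lemma is_derive_softmax_line (R : realType) (K : nat) (z v : 'cV[R]_K)
    (j : 'I_K) (t : R) (w := z + t *: v) :
  is_derive t 1 (fun s : R => softmax (z + s *: v) j)
    (softmax w j * (v j 0 - \sum_(i < K) v i 0 * softmax w i)).
Proof.
have W0 := gt_eqF (partition_fun_gt0 w).
apply: (@is_derive_eq _ _ _ _ _ _ _ _ (is_deriveM (is_derive_expR_line z v j t)
   (is_deriveV _ (is_derive_partition_fun_line z v t)))).
  by rewrite W0.
rewrite /softmax -/w; under [in RHS]eq_bigr do rewrite mulrA.
rewrite -mulr_suml /GRing.scale /=; field.
by rewrite W0.
Qed.

Lemma is_derive_expR_linear (R : realType) (b t : R) :
  is_derive t 1 (fun s : R => expR (b * s)) (expR (b * t) * b).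
Proof.
apply: is_derive1_comp.
apply: (@is_derive_eq _ _ _ (b \*: id)).
by rewrite /GRing.scale /= mulr1.
Qed.

(* For [t] in [[0, 1]] this derivative is at most
   [(2 + a) (1 - t) exp (- a t)], which bounds the integral of
   [(1 - t) exp (- a t)] from below without integrating it exactly. *)
Lemma is_derive_neg_sqr_expR (R : realType) (a t : R) :
  is_derive t 1 (fun s : R => - ((1 - s) ^+ 2 * expR (- a * s)))
    ((1 - t) * (2 + a * (1 - t)) * expR (- a * t)).
Proof.
have dE := is_derive_expR_linear (- a) t.
apply: (@is_derive_eq _ _ _ (- ((cst 1 - id) ^+ 2 * (fun s : R => expR (- a * s))))).
rewrite /GRing.scale /= !fctE; ring.
Qed.

Lemma ler_coord_norm (R : realType) (K : nat) (v : 'cV[R]_K) i :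
  `|v i 0| <= `|v|.
Proof.
rewrite [leRHS]mx_normrE.
exact: (le_bigmax _ (fun ij => `|v ij.1 ij.2|) (i, 0)).
Qed.

(** * Integrability on [[0, 1]] and integrals of finite sums *)

Lemma integrable_derivable01 (R : realType) (f : R -> R) :
  (forall x, derivable f x 1) ->
  (@lebesgue_measure R).-integrable `[0, 1] (EFin \o f).
Proof.
move=> df; apply: continuous_compact_integrable; first exact: segment_compact.
by apply: derivable_within_continuous => x _; exact: df.
Qed.

Lemma integrable_EFin_sum d (T : measurableType d) (R : realType)
    (mu : {measure set T -> \bar R}) (D : set T) (I : Type) (r : seq I)
    (f : I -> T -> R) : measurable D ->
  (forall i, mu.-integrable D (EFin \o f i)) ->
  mu.-integrable D (EFin \o (fun x => \sum_(i <- r) f i x)).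
Proof.
move=> mD fi.
have -> : EFin \o (fun x => \sum_(j <- r) f j x) =
    (fun x => \sum_(j <- r) (f j x)%:E)%E.
  by apply/funext => x /=; rewrite sumEFin.
by apply: integrable_sum => // j _; exact: fi.
Qed.

Lemma Rintegral_sum d (T : measurableType d) (R : realType)
    (mu : {measure set T -> \bar R}) (D : set T) (I : Type) (r : seq I)
    (f : I -> T -> R) : measurable D ->
  (forall i, mu.-integrable D (EFin \o f i)) ->
  \int[mu]_(x in D) (\sum_(i <- r) f i x) =
  \sum_(i <- r) \int[mu]_(x in D) f i x.
Proof.
move=> mD fi; elim: r => [|i r IH].
  rewrite big_nil; under eq_Rintegral do rewrite big_nil.
  by rewrite Rintegral_cst// mul0r.
under eq_Rintegral do rewrite big_cons.
rewrite big_cons RintegralD//; first by rewrite IH.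
exact: integrable_EFin_sum.
Qed.

(** * Gradient and Hessian of the loss *)

Lemma mnl_lossE (R : realType) (K : nat) (y : 'cV[R]_K.+1) (z : 'cV[R]_K) :
  \sum_(i < K.+1) y i 0 = 1 ->
  mnl_loss y z =
  ln (partition_fun z) - \sum_(j < K) y (lift ord0 j) 0 * z j 0.
Proof.
move=> y1; rewrite /mnl_loss -/(partition_fun z).
have -> : \sum_(i < K.+1) y i 0 * ln (expR (with_outside z i) / partition_fun z)
  = \sum_(i < K.+1) (y i 0 * with_outside z i - y i 0 * ln (partition_fun z)).
  apply: eq_bigr => i _; rewrite ln_div ?posrE ?expR_gt0 ?partition_fun_gt0//.
  by rewrite expRK mulrBr.
(* The weights [y] sum to 1, so the logarithm of the normaliser comes out with coefficient 1; the
   outside option then adds nothing, as its utility is 0. *)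
rewrite sumrB -mulr_suml y1 mul1r opprB; congr (_ - _).
rewrite big_ord_recl /with_outside unlift_none mulr0 add0r.
by apply: eq_bigr => j _; rewrite liftK.
Qed.

Lemma derive_mnl_loss (R : realType) (K : nat) (y : 'cV[R]_K.+1)
    (z : 'cV[R]_K) (j : 'I_K) : \sum_(i < K.+1) y i 0 = 1 ->
  'D_(delta_mx j 0) (mnl_loss y) z = softmax z j - y (lift ord0 j) 0.
Proof.
move=> y1; set v : 'cV[R]_K := delta_mx j 0.
have sumv (f : 'I_K -> R) : \sum_(i < K) v i 0 * f i = f j.
  rewrite (bigD1 j)//= big1 ?addr0 ?mxE ?eqxx ?mul1r// => i /negPf ij.
  by rewrite mxE ij mul0r.
apply: derive_val; apply: is_derive_line.
have -> : (fun t : R => mnl_loss y (z + t *: v)) =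
    (@ln R \o (fun t : R => partition_fun (z + t *: v))) -
    (cst (\sum_(i < K) y (lift ord0 i) 0 * z i 0) +
     id * cst (y (lift ord0 j) 0)).
  apply/funext => t; rewrite mnl_lossE// !fctE; congr (_ - _).
  rewrite -(sumv (fun i => y (lift ord0 i) 0)) mulr_sumr -big_split /=.
  by apply: eq_bigr => i _; rewrite !mxE; ring.
apply: is_deriveB; last first.
  apply: is_derive_eq.
  by rewrite /cst /= scaler0 !add0r /GRing.scale /= mulr1.
have -> : softmax z j = (partition_fun (z + 0 *: v))^-1 *
    \sum_(i < K) v i 0 * expR ((z + 0 *: v) i 0).
  by rewrite sumv scale0r addr0 mulrC.
apply: is_derive1_comp (is_derive_partition_fun_line _ _ _).
exact/is_derive1_ln/partition_fun_gt0.
Qed.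

(** The choice vector enters the gradient only as a constant, so what remains is the Hessian of the
    log-normaliser: the covariance matrix of the indicators of the choices. *)
Lemma hessian_mnl_loss (R : realType) (K : nat) (y : 'cV[R]_K.+1)
    (z : 'cV[R]_K) : \sum_(i < K.+1) y i 0 = 1 ->
  hessian (mnl_loss y) z =
  \matrix_(i, j) (softmax z j * ((j == i)%:R - softmax z i)).
Proof.
move=> y1; apply/matrixP => i j; rewrite !mxE.
under eq_fun do rewrite derive_mnl_loss//.
set v : 'cV[R]_K := delta_mx i 0.
apply: derive_val; apply: is_derive_line.
have -> : softmax z j * ((j == i)%:R - softmax z i) = softmax (z + 0 *: v) j *
    (v j 0 - \sum_(k < K) v k 0 * softmax (z + 0 *: v) k) - 0.
  rewrite scale0r addr0 subr0 mxE andbT; congr (_ * (_ - _)).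
  rewrite (bigD1 i)//= big1 ?addr0 ?mxE ?eqxx ?mul1r// => k /negPf ki.
  by rewrite mxE ki mul0r.
apply: (is_deriveB (is_derive_softmax_line z v j 0)).
Qed.

(** * The Hessian form as a variance *)

Lemma quad_formE (R : realType) (K : nat) (A : 'M[R]_K) (u : 'cV[R]_K) :
  quad_form A u = \sum_i \sum_j u j 0 * u i 0 * A j i.
Proof.
rewrite /quad_form mxE; apply: eq_bigr => i _.
rewrite mxE mulr_suml; apply: eq_bigr => j _.
by rewrite !mxE; ring.
Qed.

(* The variance of the random variable with value [u j 0] at item [j] and 0 at
   the outside option, under the choice probabilities. *)
Definition softmax_var (R : realType) (K : nat) (z u : 'cV[R]_K) : R :=
  \sum_i softmax z i * u i 0 ^+ 2 - (\sum_i softmax z i * u i 0) ^+ 2.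

Lemma quad_form_hessian (R : realType) (K : nat) (y : 'cV[R]_K.+1)
    (z u : 'cV[R]_K) : \sum_(i < K.+1) y i 0 = 1 ->
  quad_form (hessian (mnl_loss y) z) u = softmax_var z u.
Proof.
move=> y1; rewrite quad_formE hessian_mnl_loss// /softmax_var.
rewrite expr2 mulr_suml -sumrB; apply: eq_bigr => i _.
under eq_bigr do rewrite mxE mulrBr mulrBr.
rewrite sumrB mulr_sumr; congr (_ - _); last first.
  by apply: eq_bigr => j _; ring.
rewrite (bigD1 i)//= big1 ?addr0 ?eqxx ?mulr1; first by ring.
by move=> j /negPf ji; rewrite eq_sym ji !mulr0.
Qed.

(** Mean square distance to [c] equals variance plus squared distance from [c] to the mean. The
    first term is the outside option, of value 0 and probability [(partition_fun z)^-1]. *)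
Lemma softmax_var_shift (R : realType) (K : nat) (z u : 'cV[R]_K) (c : R) :
  c ^+ 2 / partition_fun z + \sum_i softmax z i * (u i 0 - c) ^+ 2 =
  softmax_var z u + (c - \sum_i softmax z i * u i 0) ^+ 2.
Proof.
have W0 := gt_eqF (partition_fun_gt0 z).
have -> : (partition_fun z)^-1 = 1 - \sum_i softmax z i.
  rewrite /softmax -mulr_suml.
  have -> : \sum_(i < K) expR (z i 0) = partition_fun z - 1.
    by rewrite /partition_fun addrC addKr.
  by field; rewrite W0.
have -> : \sum_i softmax z i * (u i 0 - c) ^+ 2 =
    \sum_i softmax z i * u i 0 ^+ 2 - 2 * c * \sum_i softmax z i * u i 0
    + c ^+ 2 * \sum_i softmax z i.
  rewrite !mulr_sumr -sumrB -big_split; apply: eq_bigr => i _ /=; ring.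
by rewrite /softmax_var; ring.
Qed.

Lemma softmax_var_ge0 (R : realType) (K : nat) (z u : 'cV[R]_K) :
  0 <= softmax_var z u.
Proof.
have := softmax_var_shift z u (\sum_i softmax z i * u i 0).
rewrite subrr expr0n addr0 => <-.
have W0 := partition_fun_gt0 z.
rewrite addr_ge0 ?divr_ge0 ?sqr_ge0 ?(ltW W0)// sumr_ge0// => i _.
by rewrite mulr_ge0 ?sqr_ge0// divr_ge0 ?expR_ge0// ltW.
Qed.

(** * Decay of the variance along a segment *)

Lemma expR_coord_line (R : realType) (K : nat) (z d : 'cV[R]_K) i (s : R) :
  0 <= s -> expR (- (s * `|d|)) * expR (z i 0) <= expR ((z + s *: d) i 0)
            <= expR (s * `|d|) * expR (z i 0).
Proof.
move=> s0; rewrite -!expRD !ler_expR !mxE ![_ + z i 0]addrC !lerD2l -mulrN.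
by rewrite !ler_wpM2l//; have := ler_coord_norm d i; rewrite ler_norml => /andP[].
Qed.

Lemma partition_fun_line (R : realType) (K : nat) (z d : 'cV[R]_K) (s : R) :
  0 <= s -> partition_fun (z + s *: d) <= expR (s * `|d|) * partition_fun z.
Proof.
move=> s0; rewrite mulrDr mulr1 lerD//.
  (* The term 1 of the outside option does not move, and the factor is at least 1. *)
  by rewrite -expR0 ler_expR mulr_ge0.
by rewrite mulr_sumr ler_sum// => i _; case/andP: (expR_coord_line z d i s0).
Qed.

(* The variance is the minimum over [c] of the mean square distance to [c], so
   it decays no faster than the probabilities do. *)
Lemma softmax_var_line (R : realType) (K : nat) (z d u : 'cV[R]_K) (s : R) :
  0 <= s ->
  expR (- (2 * `|d|) * s) * softmax_var z u <= softmax_var (z + s *: d) u.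
Proof.
(* [c] is the mean at [w], so the variance there is exactly the mean square distance to [c]. *)
move=> s0; set w := z + s *: d; set c := \sum_i softmax w i * u i 0.
have := softmax_var_shift w u c; rewrite subrr expr0n addr0 => <-.
set e := expR (- (s * `|d|)).
have -> : expR (- (2 * `|d|) * s) = e * e by rewrite -expRD; congr expR; ring.
have W0 := partition_fun_gt0 z; have Ww0 := partition_fun_gt0 w.
have e0 : 0 < e := expR_gt0 _.
have e1 : e <= 1 by rewrite -expR0 ler_expR oppr_le0 mulr_ge0.
(* The normaliser costs one factor [e] and the numerator another. The outside option has constant
   numerator, so it loses only one; [e <= 1] later weakens this to [e * e]. *)
have iW : e / partition_fun z <= (partition_fun w)^-1.
  rewrite ler_pdivrMr// ler_pdivlMl// /e expRN ler_pdivrMr ?expR_gt0// mulrC.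
  exact: partition_fun_line.
have le_softmax i : e * e * softmax z i <= softmax w i.
  have -> : e * e * softmax z i = (e * expR (z i 0)) * (e / partition_fun z).
    by rewrite /softmax; ring.
  rewrite ler_pM ?mulr_ge0 ?invr_ge0 ?expR_ge0 ?(ltW e0) ?(ltW W0)//.
  by case/andP: (expR_coord_line z d i s0).
(* At [z] the point [c] need not be the mean; adding the nonnegative excess turns the variance into
   the mean square distance to the same [c], which compares term by term. *)
apply: (@le_trans _ _ (e * e * (softmax_var z u +
    (c - \sum_i softmax z i * u i 0) ^+ 2))).
  by rewrite ler_wpM2l ?mulr_ge0 ?(ltW e0)// lerDl sqr_ge0.
rewrite -softmax_var_shift mulrDr lerD//.
  rewrite mulrCA ler_wpM2l ?sqr_ge0//; apply: le_trans iW.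
  by rewrite -mulrA ler_piMl// mulr_ge0 ?invr_ge0 ?(ltW e0) ?(ltW W0).
rewrite mulr_sumr ler_sum// => i _.
by rewrite mulrA ler_wpM2r ?sqr_ge0.
Qed.

(** * Exchanging the quadratic form with the entrywise integral *)

Lemma integrable_quad_form (R : realType) (K : nat) (F : R -> 'M[R]_K)
    (u : 'cV[R]_K) :
  (forall i j, (@lebesgue_measure R).-integrable `[0, 1]
     (EFin \o (fun s => F s i j))) ->
  (@lebesgue_measure R).-integrable `[0, 1]
    (EFin \o (fun s => quad_form (F s) u)).
Proof.
move=> iF.
have -> : (fun s => quad_form (F s) u) = (fun s => \sum_(ij : 'I_K * 'I_K)
    u ij.2 0 * u ij.1 0 * F s ij.2 ij.1).
  by apply/funext => s; rewrite quad_formE pair_bigA.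
apply: integrable_EFin_sum => //= -[i j] /=.
exact: (integrableZl _ (u j 0 * u i 0) (iF j i)).
Qed.

Lemma quad_form_mx_integral01 (R : realType) (K : nat) (F : R -> 'M[R]_K)
    (u : 'cV[R]_K) :
  (forall i j, (@lebesgue_measure R).-integrable `[0, 1]
     (EFin \o (fun s => F s i j))) ->
  quad_form (mx_integral01 F) u =
  \int[lebesgue_measure]_(s in `[0, 1]) quad_form (F s) u.
Proof.
move=> iF; rewrite quad_formE pair_bigA /=.
under eq_Rintegral do rewrite quad_formE pair_bigA /=.
rewrite Rintegral_sum//=; last first.
  by move=> [i j] /=; exact: (integrableZl _ (u j 0 * u i 0) (iF j i)).
by apply: eq_bigr => -[i j] _ /=; rewrite mxE RintegralZl.
Qed.

Lemma Rintegral_derive01 (R : realType) (F f : R -> R) :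
  (forall x : R, is_derive x 1 F (f x)) -> (forall x, derivable f x 1) ->
  \int[lebesgue_measure]_(x in `[0, 1]) f x = F 1 - F 0.
Proof.
move=> dF df; rewrite /Rintegral.
have cF : continuous F.
  move=> x; apply/differentiable_continuous/derivable1_diffP; exact: ex_derive.
rewrite (@continuous_FTC2 _ f F 0 1)//.
- by apply: derivable_within_continuous => x _; exact: df.
- by split; [move=> x _; exact: ex_derive
    | exact/cvg_at_right_filter/cF | exact/cvg_at_left_filter/cF].
- by move=> x _; rewrite derive1E derive_val.
Qed.

(* The norm on 'cV[R]_K is the library's one, i.e. the sup norm. *)
Theorem propositionB6 (R : realType) (K : nat) (y : 'cV[R]_K.+1)
    (hy : choice_vector y) (u z1 z2 : 'cV[R]_K) :
  quad_form
    (mx_integral01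
       (fun s : R => (1 - s) *: hessian (mnl_loss y) (z1 + s *: (z2 - z1)))) u
  >= (2 + 3 * Num.sqrt 2 * `|z2 - z1|)^-1
     * quad_form (hessian (mnl_loss y) z1) u.
Proof.
have y1 := hy.2; set d := z2 - z1; set a := 2 * `|d|.
have a0 : 0 <= a by rewrite mulr_ge0.
have a20 : 0 < 2 + a by rewrite ltr_wpDr.
have iH i j : (@lebesgue_measure R).-integrable `[0, 1] (EFin \o (fun s : R =>
    ((1 - s) *: hessian (mnl_loss y) (z1 + s *: d)) i j)).
  apply: integrable_derivable01 => s.
  have dp k : derivable (fun t : R => softmax (z1 + t *: d) k) s 1.
    by case: (is_derive_softmax_line z1 d k s).
  have -> : (fun t : R =>
      ((1 - t) *: hessian (mnl_loss y) (z1 + t *: d)) i j) =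
      (cst 1 - id) * ((fun t : R => softmax (z1 + t *: d) j) *
        (cst (j == i)%:R - (fun t : R => softmax (z1 + t *: d) i))).
    by apply/funext => t; rewrite hessian_mnl_loss// !mxE.
  apply: derivableM; first exact: ex_derive.
  by apply: derivableM => //; apply: derivableB => //; exact: ex_derive.
rewrite quad_form_mx_integral01// quad_form_hessian//.
set V := softmax_var z1 u; set c := (2 + a)^-1.
have V0 : 0 <= V := softmax_var_ge0 z1 u.
(* [B] is the derivative of [- (1 - s)^2 exp (- a s)], which rises from -1 to 0 on [[0, 1]]; hence
   its integral is 1. *)
pose B s := (1 - s) * (2 + a * (1 - s)) * expR (- a * s).
have dB s : derivable B s 1.
  have -> : B = (cst 1 - id) * (cst 2 + a \*: (cst 1 - id)) *
      (fun t : R => expR (- a * t)) by [].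
  apply: derivableM; first exact: ex_derive.
  by case: (is_derive_expR_linear (- a) s).
have iB : \int[lebesgue_measure]_(s in `[0, 1]) B s = 1.
  rewrite (Rintegral_derive01 (is_derive_neg_sqr_expR a))//.
  by rewrite mulr0 expR0 subrr subr0 !expr2; ring.
apply: (@le_trans _ _ (c * V)).
  rewrite ler_wpM2r// lef_pV2 ?posrE//.
  rewrite lerD2l ler_wpM2r//.
  have : (1 : R) <= Num.sqrt 2 by rewrite -[leLHS]sqrtr1 ler_sqrt// ler1n.
  by lra.
(* Spreading [c * V] over [[0, 1]] with density [B] reduces the claim to a pointwise comparison of
   integrands. *)
have -> : c * V = \int[lebesgue_measure]_(s in `[0, 1]) (c * V * B s).
  by rewrite RintegralZl ?iB ?mulr1//; exact: integrable_derivable01.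
apply: le_Rintegral => //.
- exact: (integrableZl _ (c * V) (integrable_derivable01 dB)).
- exact: integrable_quad_form.
move=> s /=; rewrite in_itv /= => /andP[s0 s1].
have -> : quad_form ((1 - s) *: hessian (mnl_loss y) (z1 + s *: d)) u =
    (1 - s) * softmax_var (z1 + s *: d) u.
  by rewrite -(quad_form_hessian _ _ y1) /quad_form -scalemxAr -scalemxAl mxE.
have s1' : 0 <= 1 - s by rewrite subr_ge0.
apply: (@le_trans _ _ ((1 - s) * (expR (- a * s) * V))); last first.
  by rewrite ler_wpM2l//; exact: softmax_var_line.
have -> : c * V * B s = c * (2 + a * (1 - s)) * ((1 - s) * (expR (- a * s) * V)).
  by rewrite /B; ring.
(* The extra factor [c * (2 + a * (1 - s))] is at most 1, because [a * (1 - s) <= a]. *)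
rewrite ler_piMl ?mulr_ge0 ?expR_ge0// mulrC ler_pdivrMr// mul1r lerD2l.
by rewrite ler_piMr// lerBlDr lerDl.
Qed.
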